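(* Let $p$ be an odd prime and $s,h\in\mathbb{N}$ with $s>1$ and $h>1$. Let $y_1,\ldots,y_m\in\mathbb{Z}_{2p^s}$ (viewed as integers in $\{1,\ldots,2p^s-1\}$) and let $1\le\ell\le m$ be such that $y_i$ is odd for $1\le i\le\ell$, $y_i$ is even for $\ell+1\le i\le m$, and $\gcd(p,\ell)=1$; assume the $2m$ elements $y_1,\ldots,y_m,2p^s-y_1,\ldots,2p^s-y_m$ are pairwise distinct. Let $S=\{(y_i,0,\ldots,0),(2p^s-y_i,0,\ldots,0): 1\le i\le m\}\subseteq\mathbb{Z}_{2p^s}^h$. Then the complement of $\mathrm{Cay}(\mathbb{Z}_{2p^s}^h,S)$ exhibits PGFR between any vertices $a$ and $b$ with $b-a=(p^s,0,\ldots,0)$.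
   Context: For a finite abelian group $G$ (written additively) and $S\subseteq G\setminus\{0\}$ with $S=-S$, the Cayley graph $\mathrm{Cay}(G,S)$ has vertex set $G$, two distinct vertices $a,b$ being adjacent iff $b-a\in S$; its complement is $\mathrm{Cay}(G,G\setminus(S\cup\{0\}))$. For a graph $\Gamma$ with adjacency matrix $A$, the transition matrix is $H(t)=\exp(-\mathbf{i}tA)$, $t\in\mathbb{R}$, and $\mathbf{e}_v$ is the standard basis vector of vertex $v$. $\Gamma$ exhibits pretty good fractional revival (PGFR) between distinct vertices $a$ and $b$ if there is a sequence of real numbers $\{t_k\}$ with $\lim_{k\to\infty}H(t_k)\mathbf{e}_a=\alpha\mathbf{e}_a+\beta\mathbf{e}_b$ for some $\alpha,\beta\in\mathbb{C}$ with $\beta\neq0$ and $|\alpha|^2+|\beta|^2=1$. *)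

(* Defs.v *)
From HB Require Import structures.
From mathcomp Require Export all_boot all_order all_algebra complex.
From mathcomp Require Export all_classical all_reals all_analysis.
Set Implicit Arguments.
Unset Strict Implicit.
Unset Printing Implicit Defensive.
Export Order.TTheory GRing.Theory Num.Theory numFieldNormedType.Exports.
Local Open Scope classical_set_scope.
Local Open Scope complex_scope.
Local Open Scope ring_scope.

(* Simple graphs are given by their adjacency relation. *)

Definition Cay (G : finZmodType) (S : {set G}) : rel G :=
  fun a b => (a != b) && (b - a \in S).

Definition gcompl (V : finType) (e : rel V) : rel V :=
  fun a b => (a != b) && ~~ e a b.

Lemma gcompl_Cay (G : finZmodType) (S : {set G}) :
  gcompl (Cay S) =2 Cay (~: (0 |: S)).
Proof.
move=> a b; rewrite /gcompl /Cay !inE subr_eq0 negb_and negb_or negbK eq_sym.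
by case: (b == a).
Qed.

(* Vertices index rows and columns through the enumeration of V. *)
Definition adjmx (K : pzRingType) (V : finType) (e : rel V) : 'M[K]_#|V| :=
  \matrix_(i, j) (e (enum_val i) (enum_val j))%:R.

Definition evec (K : pzRingType) (V : finType) (v : V) : 'cV[K]_#|V| :=
  delta_mx (enum_rank v) 0.

(* The topology on R[i] is found only through its numFieldType structure, so
   limits of matrices are taken over a generic K. *)
Definition expmx (K : numFieldType) (n : nat) (A : 'M[K]_n) : 'M[K]_n :=
  lim (series (fun k => (k`!%:R)^-1 *: A ^+ k) @ \oo).

Definition mx_cvg (K : numFieldType) (m n : nat) (u : nat -> 'M[K]_(m, n))
    (L : 'M[K]_(m, n)) : Prop :=
  u k @[k --> \oo] --> L.

Definition transition (R : realType) (V : finType) (e : rel V) (t : R) :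
    'M[R[i]]_#|V| :=
  expmx (- ('i%C * t%:C) *: adjmx R[i] e).

Definition PGFR (R : realType) (V : finType) (e : rel V) (a b : V) : Prop :=
  a != b /\
  exists (t : nat -> R) (alpha beta : R[i]),
    [/\ beta != 0,
        `|alpha| ^+ 2 + `|beta| ^+ 2 = 1 &
        mx_cvg (fun k => transition e (t k) *m evec R[i] a)
               (alpha *: evec R[i] a + beta *: evec R[i] b)].

(* The element (x, 0, ..., 0). *)
Definition first_axis (Z : nmodType) (h : nat) (x : Z) : 'rV[Z]_h :=
  \row_(j < h) (if j == 0 :> nat then x else 0).

Definition conn_set (n h m : nat) (y : 'I_m -> nat) : {set 'rV['Z_n]_h} :=
  [set first_axis h ((y i)%:R : 'Z_n) | i : 'I_m] :|:
  [set first_axis h ((n - y i)%:R : 'Z_n) | i : 'I_m].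

(* Main.v *)
From HB Require Import structures.
Require Import Defs.
From mathcomp Require Import ring lra zify.
Local Open Scope ring_scope.
Set Implicit Arguments.
Unset Strict Implicit.

(** Write [n = 2 p^s], [omega = exp(2 pi i / n)] and [zeta = - omega], so that
    [zeta^(p^s) = 1].  The characters [chi_r] diagonalise every Cayley graph on
    [Z_n^h]; for the complement the eigenvalue at [r] is
    [n^h [r = 0] - 1 - lam_j], where [j] is the first coordinate of [r] and
    [lam_j = L_j(zeta)] with [L_j = sum_i (-X)^(j y_i) + (-X)^(j (n - y_i))] in
    [Z[X]].  Here [L_j(1)] is [2 m] for [j] even and [2 m - 4 l] for [j] odd.
    If an integer polynomial vanishes at [zeta] then [p] divides its value at
    [1]; hence an integer relation [sum_j k_j lam_j = c] forces
    [sum_j k_j L_j(1) = c] modulo [p].  This is exactly the condition under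
    which Kronecker's theorem gives times [t = 2 pi (k + 1/p)], [k] a natural
    number, such that [exp(i t lam_j)] tends to [exp(2 pi i L_j(1) / p)] for all
    [j] simultaneously.  The transition matrix then tends to one scalar on the
    characters with [j] even and to another on those with [j] odd, the two being
    distinct because [p] does not divide [4 l]; as [chi_r(b - a) = (-1)^j], the
    limit sends [e_a] to a combination of [e_a] and [e_b]. *)

(** * Congruences modulo a prime between algebraic integers *)

Section IntegralCongruence.
Variable K : numFieldType.

Local Notation integral := (integralOver (intr : int -> K)).

Definition int_congr (p : nat) (x y : K) :=
  exists2 g : K, integral g & x = y + p%:R * g.

Lemma int_congr_refl p x : int_congr p x x.
Proof. by exists 0; [exact: mxpoly.integral0 | rewrite mulr0 addr0]. Qed.

Lemma int_congr_trans p y x z :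
  int_congr p x y -> int_congr p y z -> int_congr p x z.
Proof.
move=> [g ig ->] [k ik ->]; exists (k + g); first exact: mxpoly.integral_add.
by rewrite mulrDr addrA.
Qed.

Lemma int_congr_add p x y x' y' :
  int_congr p x y -> int_congr p x' y' -> int_congr p (x + x') (y + y').
Proof.
move=> [g ig ->] [k ik ->]; exists (g + k); first exact: mxpoly.integral_add.
by rewrite mulrDr addrACA.
Qed.

Lemma integral_exp n (x : K) : integral x -> integral (x ^+ n).
Proof.
move=> ix; elim: n => [|n ih]; first exact: mxpoly.integral1.
by rewrite exprS; exact: mxpoly.integral_mul.
Qed.

(** The inner binomial coefficients are multiples of [p], so the middle terms add up to [p] times an
    integral element. *)
Lemma Frobenius_congr p (x y : K) : prime p -> integral x -> integral y ->
  int_congr p ((x + y) ^+ p) (x ^+ p + y ^+ p).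
Proof.
move=> pp ix iy.
have p1 : p = p.-1.+1 by rewrite prednK // prime_gt0.
rewrite exprDn p1 big_ord_recl big_ord_recr /= -p1 subn0 bin0 /bump /= add1n.
rewrite -p1 subnn binn !expr0 mulr1 mul1r !mulr1n.
exists (\sum_(i < p.-1) (x ^+ (p - i.+1) * y ^+ i.+1 *+ ('C(p, i.+1) %/ p))).
  elim/big_ind: _ => [||i _].
  - exact: mxpoly.integral0.
  - exact: mxpoly.integral_add.
  rewrite -mulr_natr.
  apply: mxpoly.integral_mul; last exact: mxpoly.integral_nat.
  by apply: mxpoly.integral_mul; exact: integral_exp.
rewrite addrCA -addrA addrCA; congr (_ + _); rewrite addrC; congr (_ + _).
rewrite mulr_sumr; apply: eq_bigr => i _; rewrite add1n.
rewrite -[in LHS](@divnK p 'C(p, i.+1)).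
  by rewrite mulrnA mulr_natl.
by apply: prime_dvd_bin => //=; rewrite {2}p1 ltnS.
Qed.

Lemma int_congr_exp p (x y : K) : prime p -> integral y ->
  int_congr p x y -> int_congr p (x ^+ p) (y ^+ p).
Proof.
move=> pp iy [g ig ->].
have ipg : integral (p%:R * g).
  by apply: mxpoly.integral_mul => //; exact: mxpoly.integral_nat.
apply: int_congr_trans (Frobenius_congr pp iy ipg) _.
exists ((p%:R * g) ^+ p.-1 * g).
  by apply: mxpoly.integral_mul => //; exact: integral_exp.
by rewrite mulrCA -exprSr prednK // prime_gt0.
Qed.

Lemma Frobenius_congr_iter p s (x y : K) : prime p ->
  integral x -> integral y ->
  int_congr p ((x + y) ^+ (p ^ s)) (x ^+ (p ^ s) + y ^+ (p ^ s)).
Proof.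
move=> pp ix iy; elim: s => [|s ih]; first exact: int_congr_refl.
rewrite expnSr !exprM.
apply: int_congr_trans; last first.
  by apply: Frobenius_congr => //; exact: integral_exp.
by apply: int_congr_exp => //; apply: mxpoly.integral_add; exact: integral_exp.
Qed.

(** Induction through [(n + 1)^(p^s) = n^(p^s) + 1] modulo [p] settles natural numbers; an integer
    is first reduced to its remainder modulo [p]. *)
Lemma Fermat_congr p s (c : int) : prime p ->
  int_congr p (c%:~R ^+ (p ^ s)) c%:~R.
Proof.
move=> pp.
have Fermat_nat n : int_congr p (n%:R ^+ (p ^ s)) n%:R.
  elim: n => [|n ih].
    rewrite expr0n expn_eq0 -leqn0 leqNgt prime_gt0 //=.
    exact: int_congr_refl.
  rewrite -natr1; apply: int_congr_trans.
    apply: Frobenius_congr_iter => //; first exact: mxpoly.integral_nat.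
    exact: mxpoly.integral1.
  by rewrite expr1n; apply: int_congr_add => //; exact: int_congr_refl.
have [k [d ->]] : exists k : nat, exists d : int, c = k%:Z + p%:Z * d.
  exists `|(c %% p)%Z|%N, (c %/ p)%Z; rewrite gez0_abs ?modz_ge0 //.
    by rewrite {1}(divz_eq c p) addrC mulrC.
  by rewrite eqz_nat -lt0n prime_gt0.
rewrite intrD intrM.
have id : integral (d%:~R : K) by exact: mxpoly.integral_id.
apply: (@int_congr_trans _ (k%:R ^+ (p ^ s))).
  have ip : integral (p%:R * d%:~R : K).
    by apply: mxpoly.integral_mul => //; exact: mxpoly.integral_nat.
  have ik : integral (k%:R : K) by exact: mxpoly.integral_nat.
  apply: (int_congr_trans (Frobenius_congr_iter s pp ik ip)).
  have [e ->] : exists e, (p ^ s = e.+1)%N.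
    by exists (p ^ s).-1; rewrite prednK // expn_gt0 prime_gt0.
  exists ((p%:R * d%:~R) ^+ e * d%:~R).
    by apply: mxpoly.integral_mul => //; exact: integral_exp.
  by rewrite mulrCA -exprSr.
apply: (int_congr_trans (Fermat_nat k)).
exists (- d%:~R); first exact: mxpoly.integral_opp.
by rewrite /= mulrN addrK.
Qed.

(** Along Horner's recursion [f = g X + c], Frobenius splits the power, [z ^+ (p ^ s) = 1] erases
    the factor [z], and Fermat fixes [c]: the same recursion computes [f.[1]]. *)
Lemma horner_congr p s (z : K) (f : {poly int}) : prime p ->
  z ^+ (p ^ s) = 1 ->
  int_congr p ((map_poly intr f).[z] ^+ (p ^ s)) (f.[1])%:~R.
Proof.
move=> pp zP.
have iz : integral z.
  exists ('X^(p ^ s) - 1).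
    by rewrite monicXnsubC // expn_gt0 prime_gt0.
  by rewrite rmorphB rmorph1 /= map_polyXn rootE !hornerE zP subrr.
have ih_all (g : {poly int}) : integral (map_poly intr g).[z].
  elim/poly_ind: g => [|g c ih].
    by rewrite rmorph0 horner0; exact: mxpoly.integral0.
  rewrite rmorphD rmorphM /= map_polyX map_polyC /= !hornerE.
  apply: mxpoly.integral_add; last exact: mxpoly.integral_id.
  exact: mxpoly.integral_mul.
elim/poly_ind: f => [|g c ih].
  rewrite rmorph0 !horner0 expr0n expn_eq0 -leqn0 leqNgt prime_gt0 //=.
  exact: int_congr_refl.
rewrite rmorphD rmorphM /= map_polyX map_polyC /= !hornerE /=.
apply: int_congr_trans.
  apply: Frobenius_congr_iter => //; last exact: mxpoly.integral_id.
  exact: mxpoly.integral_mul.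
rewrite exprMn zP mulr1 intrD.
by apply: int_congr_add => //; exact: Fermat_congr.
Qed.

(** Rational root argument: multiplying the monic equation by [p ^ d] shows that [p] divides
    [a ^+ d]. *)
Lemma integral_div_prime p (a : int) : prime p ->
  integral (a%:~R / p%:R) -> (p%:Z %| a)%Z.
Proof.
move=> pp [q mq /rootP q0].
have p0 : p%:R != 0 :> K by rewrite pnatr_eq0 -lt0n prime_gt0.
set d := (size q).-1.
have sq : size q = d.+1.
  by rewrite /d prednK // size_poly_gt0 monic_neq0.
have : (a ^+ d)%:~R =
    (- \sum_(i < d) q`_i * a ^+ i * p%:Z ^+ (d - i.+1) * p%:Z)%:~R :> K.
  have := congr1 ( *%R^~ (p%:R ^+ d)) q0; rewrite mul0r horner_coef.
  rewrite size_map_inj_poly ?rmorph0 //; last exact: intr_inj.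
  rewrite sq big_ord_recr /= !coef_map /=.
  move: (mq); rewrite monicE lead_coefE -/d => /eqP ->.
  rewrite mulrDl mul1r expr_div_n divfK ?expf_neq0 // mulr_suml.
  move/eqP; rewrite addrC addr_eq0 => /eqP e; rewrite rmorphXn /= e.
  rewrite rmorphN /= rmorph_sum /=; congr (- _); apply: eq_bigr => i _.
  rewrite coef_map /= !rmorphM /= !rmorphXn /=.
  have -> : p%:R ^+ d = p%:R ^+ (d - i.+1) * p%:R * p%:R ^+ i :> K.
    by rewrite -mulrA -exprS -exprD subnK.
  by rewrite expr_div_n -[_ * _ * p%:R ^+ i]mulrC !mulrA divfK ?expf_neq0.
move/intr_inj => e.
have : (p%:Z %| a ^+ d)%Z.
  by rewrite e -mulr_suml -mulNr dvdz_mull.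
by rewrite !dvdzE abszX Euclid_dvdX // => /andP[].
Qed.

(* Raising [f(z) = 0] to the power [p ^ s] is a Frobenius modulo [p], which
   sends [z] to [1] and fixes the integer coefficients. *)
Lemma prime_dvd_horner1 p s (z : K) (f : {poly int}) : prime p ->
  z ^+ (p ^ s) = 1 -> (map_poly intr f).[z] = 0 -> (p%:Z %| f.[1])%Z.
Proof.
move=> pp zP fz; have [g ig] := horner_congr f pp zP; rewrite fz.
rewrite expr0n expn_eq0 -leqn0 leqNgt prime_gt0 //= => /eqP.
rewrite eq_sym addr_eq0 => /eqP e; apply: integral_div_prime => //.
rewrite e mulNr mulrAC divff ?mul1r; first exact: mxpoly.integral_opp.
by rewrite pnatr_eq0 -lt0n prime_gt0.
Qed.

End IntegralCongruence.

(** * Kronecker's theorem at integer times *)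

Section BoundedError.
Variable C : numFieldType.

(* [g] has Cesaro mean [c], with the partial sums off by a bounded amount. *)
Definition has_mean (g : nat -> C) (c : C) :=
  exists B : C, forall J, `|\sum_(j < J) g j - c *+ J| <= B.

Lemma has_meanZ a g c : has_mean g c -> has_mean (fun j => a * g j) (a * c).
Proof.
move=> [B HB]; exists (`|a| * B) => J.
by rewrite -mulr_sumr -mulrnAr -mulrBr normrM ler_wpM2l.
Qed.

Lemma has_mean_sum (I : finType) (g : I -> nat -> C) (c : I -> C) :
  (forall i, has_mean (g i) (c i)) ->
  has_mean (fun j => \sum_i g i j) (\sum_i c i).
Proof.
move=> /choice[B HB]; exists (\sum_i B i) => J.
rewrite exchange_big /= -sumrMnl -sumrB.
by apply: le_trans (ler_norm_sum _ _ _) (ler_sum _ _) => i _; exact: HB.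
Qed.

(** For [z != 1] the partial sums are [(z^J - 1) / (z - 1)], of norm at most [2 / |z - 1|]. *)
Lemma has_mean_exp (z : C) : `|z| = 1 -> has_mean (GRing.exp z) (z == 1)%:R.
Proof.
move=> z1; have [->|nz1] := eqVneq z 1.
  exists 0 => J; under eq_bigr do rewrite expr1n.
  by rewrite sumr_const card_ord subrr normr0.
have nz : `|z - 1| != 0 by rewrite normr_eq0 subr_eq0.
exists (2 / `|z - 1|) => J; rewrite mul0rn subr0.
rewrite ler_pdivlMr ?lt_def ?nz ?normr_ge0 // mulrC -normrM -subrX1.
by rewrite (le_trans (ler_normB _ _)) // normrX z1 expr1n normr1.
Qed.

End BoundedError.

(** Otherwise [c J] would exceed the sum of the first [J] terms by at least [(c - M) J], which is
    unbounded by the Archimedean property. *)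
Lemma has_mean_le (C : archiNumFieldType) (g : nat -> C) (c M : C) :
  has_mean g c -> c \is Num.real -> M \is Num.real ->
  (forall j, g j <= M) -> c <= M.
Proof.
move=> [B HB] cr Mr gM; rewrite real_leNgt //; apply/negP => Mc.
have cM : 0 < c - M by rewrite subr_gt0.
have B0 : 0 <= B by apply: le_trans (HB 0).
have [J /=] : exists J : nat, B / (c - M) < J%:R.
  by exists (Num.bound (B / (c - M))); rewrite archi_boundP // divr_ge0 // ltW.
rewrite ltr_pdivrMr // => BJ.
suff : (c - M) *+ J <= B.
  by rewrite -mulr_natl => /(lt_le_trans BJ); rewrite ltxx.
apply: le_trans (HB J); rewrite distrC mulrnBl.
have sr : \sum_(j < J) g j <= M *+ J.
  apply: (@le_trans _ _ (\sum_(j < J) M)); first by rewrite ler_sum.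
  by rewrite sumr_const card_ord.
have le1 : (c - M) *+ J <= c *+ J - \sum_(j < J) g j.
  by rewrite mulrnBl lerD2l lerN2.
rewrite -mulrnBl; apply: (le_trans le1); apply: real_ler_norm.
rewrite -(subrKA (M *+ J)) realD //.
  by rewrite realB // -mulr_natr realM // realn.
by rewrite ger0_real // subr_ge0.
Qed.

(** Bounds from below the constant term of the [q]-th power of the kernel used for Kronecker's
    theorem. The induction rests on [(q+1) C(2q+2, q+1) = 2 (2q+1) C(2q, q)]. *)
Lemma central_binomial_lb q : (4 ^ q <= (2 * q).+1 * 'C(2 * q, q))%N.
Proof.
elim: q => // q ih.
have e : (q.+1 * 'C(2 * q.+1, q.+1) = 2 * ((2 * q).+1 * 'C(2 * q, q)))%N.
  have -> : (2 * q.+1 = (2 * q).+2)%N by lia.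
  have h1 := mul_bin_diag (2 * q).+1 q.
  have h2 := mul_bin_down (2 * q).+1 q.
  have h3 := mul_bin_diag (2 * q).+2 q.
  rewrite !succnK in h1 h2 h3; nia.
rewrite expnS -(@leq_pmul2l q.+1) //.
rewrite [leqRHS]mulnCA e; nia.
Qed.

(** With [d = 1 - rho], [rho (1 + d) <= 1] bounds [rho] by [1 / (1 + d)]. For [q = t (n + 1)],
    Bernoulli gives [(1 + d)^q >= (d t)^(n + 1)], which outgrows [(2 q + 1)^n] as [t] grows. *)
Lemma poly_exp_lt (C : archiNumFieldType) (n : nat) (rho : C) :
  0 <= rho < 1 -> exists q : nat, (2 * q).+1%:R ^+ n * rho ^+ q < 1.
Proof.
move=> /andP[r0 r1]; pose d : C := 1 - rho.
have d0 : 0 < d by rewrite subr_gt0.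
have rd : rho * (1 + d) <= 1.
  have -> : rho * (1 + d) = 1 - d ^+ 2 by rewrite /d; ring.
  by rewrite gerBl exprn_ge0 // ltW.
have Bern t : d *+ t <= (1 + d) ^+ t.
  elim: t => [|t ih]; first by rewrite mulr0n expr0.
  rewrite mulrSr exprS mulrDl mul1r lerD // ler_peMr ?(ltW d0) //.
  by rewrite exprn_ege1 // lerDl ltW.
set a : C := (2 * n + 3)%:R ^+ n / d ^+ n.+1.
have [t0 ht0] : exists t : nat, a < t%:R.
  exists (Num.bound a); rewrite archi_boundP //.
  by rewrite divr_ge0 ?exprn_ge0 // ltW.
(* Being a successor, [t] is at least [1], whence [2 q + 1 <= (2 n + 3) t]; this explains the
   numerator of [a]. *)
pose t := t0.+1; have ht : a < t%:R by rewrite (lt_le_trans ht0) // ler_nat.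
exists (t * n.+1)%N.
have P0 : 0 < (1 + d) ^+ (t * n.+1) by rewrite exprn_gt0 // addr_gt0.
rewrite -(ltr_pM2r P0) mul1r -mulrA -exprMn.
apply: le_lt_trans (_ : (2 * (t * n.+1)).+1%:R ^+ n < _).
  rewrite ler_piMr ?exprn_ge0 // exprn_ile1 // mulr_ge0 //.
  by rewrite addr_ge0 // ltW.
apply: lt_le_trans (_ : (d *+ t) ^+ n.+1 <= _); last first.
  have d1 : 0 <= 1 + d by rewrite addr_ge0 // ltW.
  by rewrite exprM lerXn2r // nnegrE ?exprn_ge0 // mulrn_wge0 // ltW.
have -> : d *+ t = t%:R * d by rewrite mulr_natl.
rewrite (exprMn n.+1 t%:R d) -ltr_pdivrMr ?exprn_gt0 //.
apply: le_lt_trans (_ : a * t%:R ^+ n < _); last first.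
  by rewrite exprS ltr_pM2r // exprn_gt0 // ltr0n.
rewrite /a mulrAC ler_pM2r ?invr_gt0 ?exprn_gt0 // -exprMn.
rewrite lerXn2r ?nnegrE ?mulr_ge0 // -natrM ler_nat; rewrite /t; nia.
Qed.

Section Kronecker.
Variables (C : archiClosedFieldType) (I : finType).

(* On the unit circle this is [|1 + u|^2 / 4], in [[0, 1]]; written without
   conjugation, its powers are Laurent polynomials with positive
   coefficients. *)
Let kernel (u : C) := (1 + u) ^+ 2 / (4 * u).

Let unit_neq0 (u : C) : `|u| = 1 -> u != 0.
Proof. by move=> u1; rewrite -normr_eq0 u1 oner_eq0. Qed.

Let kernelE (u : C) : `|u| = 1 -> kernel u = `|1 + u| ^+ 2 / 4.
Proof.
move=> u1; rewrite normCK rmorphD rmorph1 /=.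
have -> : u^* = u^-1.
  by rewrite invC_norm u1 expr1n invr1 mul1r.
by rewrite /kernel; field; rewrite unit_neq0.
Qed.

Let kernel_dist (u : C) : `|u| = 1 -> kernel u = 1 - `|u - 1| ^+ 2 / 4.
Proof.
move=> u1; rewrite normCK rmorphB rmorph1 /=.
have -> : u^* = u^-1.
  by rewrite invC_norm u1 expr1n invr1 mul1r.
by rewrite /kernel; field; rewrite unit_neq0.
Qed.

Let kernel_ge0 (u : C) : `|u| = 1 -> 0 <= kernel u.
Proof. by move=> u1; rewrite kernelE // divr_ge0 // exprn_ge0. Qed.

Let kernel_le1 (u : C) : `|u| = 1 -> kernel u <= 1.
Proof. by move=> u1; rewrite kernel_dist // gerBl divr_ge0 // exprn_ge0. Qed.

Let kernel_expand (u : C) q : u != 0 -> kernel u ^+ q =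
  \sum_(k < (2 * q).+1) 'C(2 * q, k)%:R / 4 ^+ q * (u ^+ k / u ^+ q).
Proof.
move=> u0; rewrite /kernel expr_div_n -exprM exprDn mulr_suml.
apply: eq_bigr => k _; rewrite expr1n mul1r exprMn -mulr_natl invfM; ring.
Qed.

(* The product over [i] of [kernel (z i ^+ j / w i) ^+ q] has mean at least
   [(2 q + 1)^-#|I|], its constant term, because by hypothesis the resonant
   terms of the expansion are nonnegative; if no [j] approximated [w], the product
   would be at most [(1 - e^2 / 4)^q] throughout. *)
Lemma Kronecker (z w : I -> C) (e : C) :
  (forall i, `|z i| = 1) -> (forall i, `|w i| = 1) ->
  (forall k k' : I -> nat, \prod_i z i ^+ k i = \prod_i z i ^+ k' i ->
     \prod_i w i ^+ k i = \prod_i w i ^+ k' i) ->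
  0 < e -> exists j : nat, forall i, `|z i ^+ j - w i| < e.
Proof.
move=> z1 w1 rel e0; apply: contrapT => /forallNP far.
have {}far j : exists i, e <= `|z i ^+ j - w i|.
  apply: contrapT => /forallNP near; apply: (far j) => i.
  by rewrite real_ltNge ?normr_real ?gtr0_real //; apply/negP; exact: near.
pose u i j := z i ^+ j / w i.
have u1 i j : `|u i j| = 1 by rewrite normf_div normrX z1 w1 expr1n divr1.
have z0 i : z i != 0 by exact: unit_neq0.
have w0 i : w i != 0 by exact: unit_neq0.
pose rho : C := 1 - e ^+ 2 / 4.
have dist_u i j : `|z i ^+ j - w i| = `|u i j - 1|.
  have -> : z i ^+ j - w i = w i * (u i j - 1) by rewrite /u; field.
  by rewrite normrM w1 mul1r.
have far_kernel i j : e <= `|z i ^+ j - w i| -> kernel (u i j) <= rho.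
  rewrite dist_u kernel_dist // lerD2l lerN2 => ?.
  by rewrite ler_pM2r ?invr_gt0 // lerXn2r // nnegrE ltW.
(* As [e] may be large, [0 <= rho] comes from a far coordinate at time [0]: its kernel is
   nonnegative and at most [rho]. *)
have rho01 : 0 <= rho < 1.
  apply/andP; split; last by rewrite gtrBl divr_gt0 // exprn_gt0.
  have [i ei] := far 0; apply: le_trans (far_kernel _ _ ei).
  exact: kernel_ge0.
have [q] := poly_exp_lt #|I| rho01.
pose P j := \prod_i kernel (u i j) ^+ q.
pose c (k : nat) : C := 'C(2 * q, k)%:R / 4 ^+ q.
have c0 k : 0 <= c k by rewrite divr_ge0 // exprn_ge0.
(* A monomial of the expanded product is indexed by [f], with exponent [f i - q] in coordinate [i];
   its dependence on [j] is the factor [zk f ^+ j]. *)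
pose zk (f : {ffun I -> 'I_(2 * q).+1}) := \prod_i (z i ^+ f i / z i ^+ q).
pose wk (f : {ffun I -> 'I_(2 * q).+1}) := \prod_i (w i ^+ f i / w i ^+ q).
have zk1 f : `|zk f| = 1.
  rewrite normr_prod big1 // => i _.
  by rewrite normf_div !normrX z1 !expr1n divr1.
pose term (f : {ffun I -> 'I_(2 * q).+1}) := (\prod_i c (f i)) / wk f.
pose mean := \sum_f term f * (zk f == 1)%:R.
(* Each monomial is geometric in [j], so only those with [zk f = 1] survive in the mean. *)
have meanP : has_mean P mean.
  have [B HB] : has_mean (fun j => \sum_f term f * zk f ^+ j) mean.
    by apply: has_mean_sum => f; apply: has_meanZ; exact: has_mean_exp.
  exists B => J; suff -> : \sum_(j < J) P j =
    \sum_(j < J) \sum_f term f * zk f ^+ j by exact: HB.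
  apply: eq_bigr => j _; rewrite /P.
  under eq_bigr do rewrite kernel_expand ?unit_neq0 //.
  rewrite bigA_distr_bigA; apply: eq_bigr => f _ /=.
  rewrite /term /wk /zk -prodrXl -prodfV -!big_split /=; apply: eq_bigr => i _.
  rewrite -[RHS]mulrA; congr (_ * _); rewrite /u !expr_div_n !invfM !invrK.
  rewrite -!exprM !(mulnC j); ring.
have wk_rel f : zk f = 1 -> wk f = 1.
  rewrite /zk /wk !big_split /= !prodfV => h.
  have n0 (v : I -> C) : (forall i, v i != 0) -> \prod_i v i ^+ q != 0.
    by move=> v0; apply/prodf_neq0 => i _; rewrite expf_neq0.
  rewrite (rel (fun i => f i) (fun=> q)) ?divff ?n0 //.
  by rewrite -[LHS](divfK (n0 _ z0)) h mul1r.
have meanE : mean = \sum_(f : {ffun I -> 'I_(2 * q).+1})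
    (\prod_i c (f i)) * (zk f == 1)%:R.
  apply: eq_bigr => f _; rewrite /term.
  by have [/wk_rel ->|] := eqVneq (zk f) 1; rewrite ?invr1 ?mulr1 // !mulr0.
have le_mean : (2 * q).+1%:R^-1 ^+ #|I| <= mean.
  rewrite meanE; have qlt : (q < (2 * q).+1)%N by lia.
  pose f0 : {ffun I -> 'I_(2 * q).+1} := [ffun=> Ordinal qlt].
  rewrite (bigD1 f0) //=; apply: ler_wpDr.
    by rewrite sumr_ge0 // => f _; rewrite mulr_ge0 // prodr_ge0.
  have -> : zk f0 = 1.
    by rewrite /zk big1 // => i _; rewrite ffunE divff // expf_neq0.
  rewrite eqxx mulr1 -prodr_const; apply: ler_prod => i _.
  rewrite invr_ge0 ler0n ffunE /c /= ler_pdivlMr ?exprn_gt0 //.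
  rewrite mulrC ler_pdivrMr ?ltr0n // -natrX -natrM ler_nat mulnC.
  exact: central_binomial_lb.
have mean_le : mean <= rho ^+ q.
  apply: has_mean_le meanP _ _ _.
  - rewrite meanE ger0_real // sumr_ge0 // => f _.
    by rewrite mulr_ge0 // prodr_ge0.
  - by rewrite realX // ger0_real //; case/andP: rho01.
  - move=> j; have [i /far_kernel ei] := far j.
    rewrite /P (bigD1 i) //= -[leRHS]mulr1 ler_pM ?exprn_ge0 ?kernel_ge0 //.
    + by rewrite prodr_ge0 // => k _; rewrite exprn_ge0 ?kernel_ge0.
    + by rewrite lerXn2r ?nnegrE ?kernel_ge0 //; case/andP: rho01.
    + apply: prodr_ile1 => k _; rewrite exprn_ge0 ?kernel_ge0 //=.
      by rewrite exprn_ile1 ?kernel_ge0 ?kernel_le1.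
have ge1 : 1 <= (2 * q).+1%:R ^+ #|I| * rho ^+ q.
  rewrite -ler_pdivrMl ?exprn_gt0 ?ltr0n // mulr1 -exprVn.
  exact: le_trans mean_le.
by move=> /(le_lt_trans ge1); rewrite ltxx.
Qed.

End Kronecker.

(** * Matrix exponentials and the unit circle *)

Section Convergence.
Local Open Scope classical_set_scope.
Variable K : numFieldType.

(* Convergence written without filters, because [R[i]] carries its topology
   only when viewed as a generic [numFieldType]. *)
Definition eps_cvg (u : nat -> K) (l : K) :=
  forall e, 0 < e -> exists N, forall k, (N <= k)%N -> `|l - u k| < e.

Lemma eps_cvg_sum_mx (m n : nat) (I : finType) (u : I -> nat -> K) (l : I -> K)
    (Q : I -> 'M[K]_(m, n)) :
  (forall r, eps_cvg (u r) (l r)) ->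
  mx_cvg (fun k => \sum_r u r k *: Q r) (\sum_r l r *: Q r).
Proof.
move=> ul; rewrite /mx_cvg.
have {}ul r : u r k *: Q r @[k --> \oo] --> l r *: Q r.
  apply: cvgZr_tmp; apply/cvgrPdist_lt => e e0; have [N HN] := ul r e e0.
  by exists N.
rewrite (_ : (fun k => _) = \sum_r (fun k => u r k *: Q r)); last first.
  by apply/funext => k; rewrite fct_sumE.
apply: (@big_ind2 _ _ (fun f a => f k @[k --> \oo] --> a))
  => [|f a g b fa gb|r _].
- exact: cvg_cst.
- exact: cvgD.
- exact: ul.
Qed.

(** The partial sums of the matrix series are combinations of the fixed matrices [P r], so the limit
    is taken coefficient by coefficient. *)
Lemma expmx_spectral (n : nat) (I : finType) (theta E : I -> K)
    (P : I -> 'M[K]_n) (A : 'M[K]_n) :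
  (forall k, A ^+ k = \sum_r theta r ^+ k *: P r) ->
  (forall r,
    eps_cvg (fun k => \sum_(0 <= j < k) theta r ^+ j / j`!%:R) (E r)) ->
  expmx A = \sum_r E r *: P r.
Proof.
move=> AE EE; rewrite /expmx; apply: cvg_lim; first exact: norm_hausdorff.
rewrite (_ : series _ = fun k =>
  \sum_r (\sum_(0 <= j < k) theta r ^+ j / j`!%:R) *: P r).
  exact: eps_cvg_sum_mx.
apply/funext => k; rewrite /series /=.
under eq_bigr do rewrite AE scaler_sumr.
rewrite exchange_big /=; apply: eq_bigr => r _; rewrite scaler_suml.
by apply: eq_bigr => j _; rewrite scalerA mulrC.
Qed.

End Convergence.

Section UnitCircle.
Local Open Scope classical_set_scope.
Local Open Scope complex_scope.
Variable R : realType.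
Implicit Types x y : R.

Definition cis x : R[i] := cos x +i* sin x.

Lemma cisD x y : cis (x + y) = cis x * cis y.
Proof. by rewrite /cis cosD sinD [sin x * _ + _]addrC. Qed.

Lemma cis0 : cis 0 = 1.
Proof. by rewrite /cis cos0 sin0. Qed.

Lemma norm_cis x : `|cis x| = 1.
Proof. by rewrite normc_def /= cos2Dsin2 sqrtr1. Qed.

Lemma cis_neq0 x : cis x != 0.
Proof. by rewrite -normr_eq0 norm_cis oner_eq0. Qed.

Lemma cisN x : cis (- x) = (cis x)^-1.
Proof.
by apply: (mulIf (cis_neq0 x)); rewrite -cisD addNr cis0 mulVf // cis_neq0.
Qed.

Lemma cis_mulrn x k : cis (x *+ k) = cis x ^+ k.
Proof.
elim: k => [|k ih]; first by rewrite mulr0n cis0.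
by rewrite mulrS cisD ih exprS.
Qed.

Lemma norm_real_complex x : `|x%:C| = `|x|%:C.
Proof. by rewrite normc_def /= expr0n addr0 sqrtr_sqr. Qed.

Lemma normc_le_Re_Im (z : R[i]) :
  `|z| <= (`|complex.Re z| + `|complex.Im z|)%:C.
Proof.
rewrite [z in `|z|]complexE; apply: le_trans (ler_normD _ _) _.
have i1 : `|'i%C| = 1 :> R[i].
  by rewrite normc_def /= expr0n expr1n add0r sqrtr1.
by rewrite normrM i1 mul1r !norm_real_complex rmorphD.
Qed.

Lemma gt0_complex (e : R[i]) : 0 < e -> exists2 r : R, 0 < r & e = r%:C.
Proof.
rewrite ltcE => /andP[/eqP /= e0 r0]; exists (complex.Re e) => //.
by case: e e0 r0 => a b /= ->.
Qed.

(** Powers of [i] are real for even [j] and imaginary for odd [j], where [cos_coeff] and [sin_coeff]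
    are respectively supported. *)
Lemma exp_i_termE x j :
  ('i%C * x%:C) ^+ j / j`!%:R = cos_coeff x j +i* sin_coeff x j.
Proof.
have -> : (j`!%:R : R[i])^-1 = (j`!%:R^-1 : R)%:C.
  by rewrite fmorphV rmorph_nat.
have iX : 'i%C ^+ j = ((~~ odd j)%:R * (-1) ^+ j./2) +i*
    ((odd j)%:R * (-1) ^+ j.-1./2) :> R[i].
  have N1X k : (-1) ^+ k = ((-1) ^+ k)%:C :> R[i] by rewrite rmorphXn rmorphN1.
  rewrite -[j in LHS]odd_double_half exprD -mul2n exprM sqr_i N1X.
  case: (boolP (odd j)) => oj /=; last first.
    by rewrite expr0 mul1r mul0r mul1r.
  have -> : j.-1./2 = j./2 by lia.
  rewrite expr1 mul0r mul1r; apply/eqP.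
  rewrite eq_complex /=; apply/andP; split; apply/eqP; ring.
rewrite exprMn iX -rmorphXn /cos_coeff /sin_coeff /=; apply/eqP.
by rewrite eq_complex /= !(mulr0, subr0, addr0, add0r) !eqxx.
Qed.

Lemma exp_i_eps_cvg x :
  eps_cvg (fun k => \sum_(0 <= j < k) ('i%C * x%:C) ^+ j / j`!%:R) (cis x).
Proof.
move=> _ /gt0_complex[e e0 ->].
have sumE k : \sum_(0 <= j < k) ('i%C * x%:C) ^+ j / j`!%:R =
    series (cos_coeff x) k +i* series (sin_coeff x) k.
  rewrite /series /=; elim: k => [|k ih]; first by rewrite !big_geq.
  by rewrite !big_nat_recr //= ih exp_i_termE.
have e20 : 0 < e / 2 by rewrite divr_gt0.
have : series (cos_coeff x) @ \oo --> cos x.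
  by rewrite unlock; exact: is_cvg_series_cos_coeff.
have : series (sin_coeff x) @ \oo --> sin x.
  by rewrite unlock; exact: is_cvg_series_sin_coeff.
move=> /cvgrPdist_lt/(_ _ e20)[N1 _ HN1] /cvgrPdist_lt/(_ _ e20)[N2 _ HN2].
exists (maxn N1 N2) => k; rewrite geq_max => /andP[k1 k2].
rewrite sumE; apply: le_lt_trans (normc_le_Re_Im _) _.
rewrite ltcR [ltRHS]splitr ltrD //; [exact: HN2 | exact: HN1].
Qed.

(** Angles are measured in full turns, so that the kernel is exactly the integers. *)
Definition turn x := cis (2 * pi * x).

Lemma turnD x y : turn (x + y) = turn x * turn y.
Proof. by rewrite /turn mulrDr cisD. Qed.

Lemma turnN x : turn (- x) = (turn x)^-1.
Proof. by rewrite /turn mulrN cisN. Qed.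

Lemma turn0 : turn 0 = 1.
Proof. by rewrite /turn mulr0 cis0. Qed.

Lemma norm_turn x : `|turn x| = 1. Proof. exact: norm_cis. Qed.

Lemma turn_neq0 x : turn x != 0. Proof. exact: cis_neq0. Qed.

Lemma turn_mulrn x k : turn (x *+ k) = turn x ^+ k.
Proof. by rewrite /turn mulrnAr cis_mulrn. Qed.

Lemma turn_int (z : int) : turn z%:~R = 1.
Proof.
have turn1 : turn 1 = 1.
  by rewrite /turn mulr1 /cis mulr_natl cos2pi sin2pi.
have turn_nat k : turn k%:R = 1 by rewrite turn_mulrn turn1 expr1n.
by case: z => k; rewrite ?NegzE ?mulrNz ?turnN !turn_nat ?invr1.
Qed.

(** On the fractional part [y], [cos (2 pi y) = 1] forces [sin (pi y) = 0], but this sine is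
    positive for [0 < y < 1]. *)
Lemma turn_eq1 x : turn x = 1 -> exists z : int, x = z%:~R.
Proof.
move=> x1; exists (Num.floor x).
pose y := x - (Num.floor x)%:~R.
have /andP[lo hi] := floor_itv x.
have : turn y = 1 by rewrite /y turnD turnN turn_int invr1 mulr1.
have y0 : 0 <= y by rewrite subr_ge0.
have y1 : y < 1 by rewrite ltrBlDl -(intrD _ _ 1).
move: y0; rewrite le_eqVlt => /predU1P[/esym/eqP|y0].
  by rewrite subr_eq0 => /eqP.
move=> [cos1 _].
have : 0 < sin (pi * y).
  by rewrite sin_gt0_pi // mulr_gt0 ?pi_gt0 //= gtr_pMr // pi_gt0.
have : sin (pi * y) ^+ 2 = 0.
  move: cos1; rewrite -mulrA mulr_natl cos_mulr2n sin2cos2 => h; lra.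
by move=> /eqP; rewrite sqrf_eq0 => /eqP ->; rewrite ltxx.
Qed.

End UnitCircle.

(** * Characters and spectra of Cayley graphs *)

Section CayleySpectrum.
Local Open Scope complex_scope.
Variables (R : realType) (G I : finZmodType) (chi : I -> G -> R[i]).
Hypothesis chiD : forall r x y, chi r (x + y) = chi r x * chi r y.
Hypothesis chi_sum : forall x, \sum_r chi r x = (#|G| * (x == 0))%:R.

Let card_neq0 : #|G|%:R != 0 :> R[i].
Proof. by rewrite pnatr_eq0 -lt0n; apply/card_gt0P; exists 0. Qed.

(** For a character, this is the orthogonal projector onto the line it spans. *)
Definition char_proj (r : I) : 'M[R[i]]_#|G| :=
  \matrix_(i, j) (chi r (enum_val i - enum_val j) / #|G|%:R).

Lemma sum_char_proj : \sum_r char_proj r = 1%:M.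
Proof.
apply/matrixP => i j; rewrite summxE !mxE.
under eq_bigr do rewrite mxE.
rewrite -mulr_suml chi_sum natrM subr_eq0 (inj_eq enum_val_inj).
by rewrite mulrAC divff // mul1r.
Qed.

(** Columns of [char_proj r] are multiples of [chi r]; summing over the neighbours [x + d] of [x]
    pulls out the factors [chi r d]. *)
Lemma adjmx_char_proj (T : {set G}) (r : I) : 0 \notin T ->
  adjmx R[i] (Cay T) *m char_proj r = (\sum_(d in T) chi r d) *: char_proj r.
Proof.
move=> T0; apply/matrixP => i j; rewrite !mxE.
under eq_bigr do rewrite !mxE.
rewrite (reindex _ (onW_bij _ (@enum_rank_bij G))) /=.
under eq_bigr do rewrite enum_rankK.
rewrite (reindex_inj (addrI (enum_val i))) /= mulr_suml [RHS]big_mkcond /=.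
apply: eq_bigr => d _; rewrite /Cay addrAC subrr add0r.
rewrite eq_sym -subr_eq0 addrAC subrr add0r.
have [dT|] := boolP (d \in T); last by rewrite andbF mul0r.
have -> : d != 0 by apply: contraNneq T0 => <-.
by rewrite mul1r mulrA -chiD addrA [enum_val i + d]addrC.
Qed.

Lemma scale_adjmx_exp (T : {set G}) (c : R[i]) k : 0 \notin T ->
  (c *: adjmx R[i] (Cay T)) ^+ k =
  \sum_r (c * \sum_(d in T) chi r d) ^+ k *: char_proj r.
Proof.
move=> T0; elim: k => [|k ih].
  by under eq_bigr do rewrite expr0 scale1r; rewrite sum_char_proj.
rewrite exprS ih -[LHS]/(_ *m _) mulmx_sumr; apply: eq_bigr => r _.
by rewrite -scalemxAr -scalemxAl adjmx_char_proj // !scalerA exprSr mulrA.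
Qed.

Lemma transition_Cay (T : {set G}) (theta : I -> R) (t : R) : 0 \notin T ->
  (forall r, \sum_(d in T) chi r d = (theta r)%:C) ->
  transition (Cay T) t = \sum_r cis (- (t * theta r)) *: char_proj r.
Proof.
move=> T0 thetaE; rewrite /transition.
apply: (@expmx_spectral _ _ _ (fun r => 'i%C * (- (t * theta r))%:C)).
  move=> k; rewrite scale_adjmx_exp //; apply: eq_bigr => r _.
  rewrite thetaE; congr (_ ^+ k *: _).
  by rewrite rmorphN rmorphM /=; ring.
by move=> r; exact: exp_i_eps_cvg.
Qed.

Lemma char_proj_evec (r : I) a b :
  char_proj r *m evec R[i] b = chi r (a - b) *: (char_proj r *m evec R[i] a).
Proof.
rewrite /evec -!colE; apply/matrixP => i j; rewrite !mxE !enum_rankK.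
by rewrite mulrA -chiD [a - b + _]addrC addrA subrK.
Qed.

(** [char_proj r] sends [alpha e_a + beta e_b] to [alpha + beta chi_r(a - b)] times its image of
    [e_a], so the limit reduces to one scalar limit per character. *)
Lemma PGFR_Cay (T : {set G}) (theta : I -> R) (t : nat -> R) a b
    (alpha beta : R[i]) : 0 \notin T ->
  (forall r, \sum_(d in T) chi r d = (theta r)%:C) ->
  a != b -> beta != 0 -> `|alpha| ^+ 2 + `|beta| ^+ 2 = 1 ->
  (forall r, eps_cvg (fun k => cis (- (t k * theta r)))
    (alpha + beta * chi r (a - b))) ->
  PGFR R (Cay T) a b.
Proof.
move=> T0 thetaE ab b0 ab1 lim_t; split=> //; exists t, alpha, beta; split=> //.
have -> : (fun k => transition (Cay T) (t k) *m evec R[i] a) =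
    (fun k => \sum_r cis (- (t k * theta r)) *: (char_proj r *m evec R[i] a)).
  apply/funext => k; rewrite (transition_Cay _ T0 thetaE) mulmx_suml.
  by apply: eq_bigr => r _; rewrite scalemxAl.
have -> : alpha *: evec R[i] a + beta *: evec R[i] b =
    \sum_r (alpha + beta * chi r (a - b)) *: (char_proj r *m evec R[i] a).
  rewrite -[evec _ a in LHS]mul1mx -[evec _ b]mul1mx -sum_char_proj.
  rewrite !mulmx_suml !scaler_sumr -big_split /=; apply: eq_bigr => r _.
  by rewrite scalerDl -scalerA -char_proj_evec.
exact: eps_cvg_sum_mx.
Qed.

End CayleySpectrum.

(** * Characters of [Z_n^h] and their orthogonality *)

Section Characters.
Variables (R : realType) (n h : nat).
Hypothesis n_gt1 : (1 < n)%N.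

Definition Zn_char (x : 'Z_n) : R[i] := turn ((x : nat)%:R / n%:R).

Let n_neq0 : n%:R != 0 :> R.
Proof. by rewrite pnatr_eq0; lia. Qed.

Lemma Zn_char_nat k : Zn_char k%:R = turn (k%:R / n%:R).
Proof.
rewrite /Zn_char val_Zp_nat // [in RHS](divn_eq k n) natrD natrM mulrDl.
rewrite mulfK // turnD -[(k %/ n)%:R]/(((k %/ n)%N : int)%:~R).
by rewrite turn_int mul1r.
Qed.

Lemma Zn_charD x y : Zn_char (x + y) = Zn_char x * Zn_char y.
Proof.
rewrite -(natr_Zp x) -(natr_Zp y) -natrD !Zn_char_nat.
by rewrite natrD mulrDl turnD.
Qed.

Lemma Zn_char_eq1 x : Zn_char x = 1 -> x = 0.
Proof.
move=> /turn_eq1[z xz]; apply: val_inj => /=.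
have xn : (x < n)%N by rewrite -[n in (_ < n)%N](Zp_cast n_gt1).
have n0 : 0 < n%:R :> R by rewrite ltr0n; lia.
have : 0 <= z%:~R :> R by rewrite -xz divr_ge0.
have : z%:~R < 1 :> R by rewrite -xz ltr_pdivrMr // mul1r ltr_nat.
rewrite ler0z -[1]/(1%:~R) ltr_int => z1 z0.
have z00 : z = 0 by lia.
move: xz; rewrite z00 => /(canRL (divfK n_neq0)); rewrite mul0r => /eqP.
by rewrite pnatr_eq0 => /eqP.
Qed.

Definition rV_char (r g : 'rV['Z_n]_h) : R[i] := Zn_char ((r *m g^T) 0 0).

Lemma rV_charC r g : rV_char r g = rV_char g r.
Proof.
rewrite /rV_char; congr Zn_char; rewrite !mxE; apply: eq_bigr => i _.
by rewrite !mxE mulrC.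
Qed.

Lemma rV_charDr r g g' : rV_char r (g + g') = rV_char r g * rV_char r g'.
Proof. by rewrite /rV_char linearD mulmxDr mxE Zn_charD. Qed.

Lemma rV_char0r r : rV_char r 0 = 1.
Proof. by rewrite /rV_char trmx0 mulmx0 mxE /Zn_char mul0r turn0. Qed.

(** Translating by some [r0] with [rV_char r0 g != 1] multiplies the sum by that value, so the sum
    vanishes unless [g = 0]. *)
Lemma rV_char_sum g : \sum_r rV_char r g = (#|'rV['Z_n]_h| * (g == 0))%:R.
Proof.
have [->|g0] := eqVneq g 0.
  under eq_bigr do rewrite rV_char0r.
  by rewrite sumr_const muln1.
rewrite muln0.
have [i gi0] : exists i, g 0 i != 0 by apply/rV0Pn.
pose r0 : 'rV['Z_n]_h := delta_mx 0 i.
have r0g : rV_char r0 g != 1.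
  apply: contra gi0 => /eqP /Zn_char_eq1.
  by rewrite -rowE !mxE => ->.
have : rV_char r0 g * (\sum_r rV_char r g) = \sum_r rV_char r g.
  rewrite [RHS](reindex_inj (addrI r0)) mulr_sumr; apply: eq_bigr => r _.
  by rewrite !(rV_charC _ g) rV_charDr.
move/eqP; rewrite -subr_eq0 -[X in _ - X]mul1r -mulrBl mulf_eq0 subr_eq0.
by rewrite (negPf r0g) => /eqP.
Qed.

End Characters.

(** * Simultaneous approximation of the eigenvalues *)

(** Makes [Kronecker] applicable to [R[i]], through the instance declared next. *)
Lemma complex_archimedean (R : realType) : Num.archimedean_axiom R[i].
Proof.
move=> z; pose x := Num.sqrt (complex.Re z ^+ 2 + complex.Im z ^+ 2).
exists (Num.bound x); rewrite normc_def -(rmorph_nat (real_complex R)) ltcR.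
by rewrite archi_boundP // sqrtr_ge0.
Qed.

HB.instance Definition _ (R : realType) :=
  Num.NumDomain_bounded_isArchimedean.Build R[i] (@complex_archimedean R).

Section TurnApproximation.
Local Open Scope complex_scope.
Variable R : realType.

Lemma turn_sum (J : finType) (x : J -> R) :
  turn (\sum_j x j) = \prod_j turn (x j).
Proof. exact: (big_morph _ (@turnD R) (turn0 R)). Qed.

Lemma turn_half : turn (2^-1 : R) = -1.
Proof.
rewrite /turn mulrAC divff ?mul1r; last by rewrite pnatr_eq0.
by rewrite /cis cospi sinpi; apply/eqP; rewrite eq_complex /= oppr0 !eqxx.
Qed.

Lemma turn_inj_mod1 (x y : R) :
  turn x = turn y -> exists c : int, x - y = c%:~R.
Proof.
by move=> e; apply: turn_eq1; rewrite turnD turnN e divff ?turn_neq0.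
Qed.

Lemma turnB_int (x y : R) (c : int) : x - y = c%:~R -> turn x = turn y.
Proof. by move=> e; rewrite -[x](subrK y) e turnD turn_int mul1r. Qed.

(* Every integer relation among the [lam j] comes from a polynomial vanishing
   at [zeta], hence persists modulo [p] among the values [(L j).[1]]. *)
Lemma turn_approx (J : finType) (p s : nat) (zeta : R[i])
    (L : J -> {poly int}) (lam : J -> R) (e : R[i]) :
  prime p -> zeta ^+ (p ^ s) = 1 ->
  (forall j, (map_poly intr (L j)).[zeta] = (lam j)%:C) -> 0 < e ->
  exists k : nat, forall j,
    `|turn ((k%:R + p%:R^-1) * lam j) - turn ((L j).[1]%:~R / p%:R)| < e.
Proof.
move=> pp zP Lz e0.
have p0 : p%:R != 0 :> R by rewrite pnatr_eq0 -lt0n prime_gt0.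
pose z j := turn (lam j).
(* The time will be [k + 1/p]: the target is divided in advance by [turn (lam j / p)], the
   contribution of the shift. *)
pose w j := turn (((L j).[1]%:~R - lam j) / p%:R).
have prodE (x : J -> R) (k : J -> nat) :
    \prod_j turn (x j) ^+ k j = turn (\sum_j x j *+ k j).
  by rewrite turn_sum; apply: eq_bigr => j _; rewrite turn_mulrn.
have rel k k' : \prod_j z j ^+ k j = \prod_j z j ^+ k' j ->
    \prod_j w j ^+ k j = \prod_j w j ^+ k' j.
  rewrite !prodE -!/(z _) => /turn_inj_mod1[c]; rewrite -sumrB => hc.
  (* [f] encodes the relation: it vanishes at [zeta], and [f.[1] / p] is the difference of the two
     angles to be compared. *)
  pose f : {poly int} := \sum_j (L j *+ k j - L j *+ k' j) - c%:P.
  have fz : (map_poly intr f).[zeta] = 0.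
    rewrite rmorphB rmorph_sum /= map_polyC /= hornerD hornerN hornerC.
    rewrite horner_sum -[c%:~R](rmorph_int (real_complex R)) -hc rmorph_sum /=.
    apply/eqP; rewrite subr_eq0; apply/eqP; apply: eq_bigr => j _.
    by rewrite !rmorphB !rmorphMn /= hornerD hornerN !hornerMn Lz.
  have /dvdzP[d] := prime_dvd_horner1 pp zP fz.
  rewrite hornerD hornerN hornerC horner_sum => hd.
  apply: (@turnB_int _ _ d); apply: (mulIf p0).
  transitivity ((d * p%:Z)%:~R : R); last by rewrite intrM.
  rewrite -hd rmorphB /= -hc rmorph_sum /= -sumrB -sumrB mulr_suml.
  apply: eq_bigr => j _; rewrite hornerD hornerN !hornerMn rmorphB !rmorphMn /=.
  rewrite mulrBl !mulrnAl !divfK // !mulrnBl !opprB addrACA.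
  by rewrite [_ *- _ - _]addrC addrACA.
have [k hk] :=
  @Kronecker R[i] J z w e (fun=> norm_turn _) (fun=> norm_turn _) rel e0.
exists k => j; have := hk j.
rewrite -[X in X < _ -> _]mul1r -(norm_turn (lam j / p%:R)) -normrM mulrBr.
rewrite -turn_mulrn -!turnD.
have -> : lam j / p%:R + lam j *+ k = (k%:R + p%:R^-1) * lam j.
  by rewrite mulrDl mulr_natl addrC [_^-1 * _]mulrC.
by rewrite -mulrDl [lam j + _]addrC subrK.
Qed.

End TurnApproximation.

(** * Character sums over the connection set and its complement *)

Section FirstAxis.
Variables (R : realType) (n h : nat).
Hypothesis n_gt1 : (1 < n)%N.

Lemma first_axis_inj : injective (@first_axis 'Z_n h.+1).
Proof. by move=> x y /rowP/(_ ord0); rewrite !mxE. Qed.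

Lemma first_axis0 : @first_axis 'Z_n h.+1 0 = 0.
Proof. by apply/rowP => i; rewrite !mxE if_same. Qed.

Lemma rV_char_first_axis (r : 'rV['Z_n]_h.+1) x :
  rV_char R r (first_axis h.+1 x) = Zn_char R (r 0 ord0 * x).
Proof.
rewrite /rV_char mxE big_ord_recl !mxE /= big1 ?addr0 // => i _.
by rewrite !mxE mulr0.
Qed.

Lemma Zn_char_mul_nat (r : 'Z_n) k :
  Zn_char R (r * k%:R) = turn n%:R^-1 ^+ (r * k).
Proof.
by rewrite -[r in LHS](natr_Zp r) -natrM Zn_char_nat // -turn_mulrn mulr_natl.
Qed.

Lemma natr_Zn_inj (x y : nat) : (x < n)%N -> (y < n)%N ->
  x%:R = y%:R :> 'Z_n -> x = y.
Proof.
by move=> xn yn /(congr1 val) /=; rewrite !val_Zp_nat // !modn_small.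
Qed.

Section ConnSet.
Variables (m : nat) (y : 'I_m -> nat).
Hypothesis y_bound : forall i, (1 <= y i <= n - 1)%N.
Hypothesis y_distinct :
  uniq ([seq y i | i : 'I_m] ++ [seq (n - y i)%N | i : 'I_m]).

Lemma conn_set_neq0 : 0 \notin conn_set n h.+1 y.
Proof.
rewrite !inE negb_or; apply/andP; split; apply/imsetP => -[i _];
  rewrite -first_axis0 => /first_axis_inj; rewrite -[0]/(0%:R) => /natr_Zn_inj;
  have := y_bound i; lia.
Qed.

(** The two families are injective and disjoint because the [2 m] integers are distinct and less
    than [n], so the sum over the set is a sum over [i]. *)
Lemma conn_set_char_sum (r : 'rV['Z_n]_h.+1) :
  \sum_(d in conn_set n h.+1 y) rV_char R r d =
  \sum_i (turn n%:R^-1 ^+ (r 0 ord0 * y i) +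
          turn n%:R^-1 ^+ (r 0 ord0 * (n - y i))).
Proof.
move: y_distinct; rewrite cat_uniq => /and3P[/injectiveP y_inj + _].
move=> /hasPn disj.
have y_lt i : (y i < n)%N by have := y_bound i; lia.
have ny_lt i : (n - y i < n)%N by have := y_bound i; lia.
rewrite (eq_bigl _ _ (fun d => finset.in_setU d _ _)) bigU /=; last first.
  rewrite disjoint_subset; apply/fintype.subsetP => _ /imsetP[i _ ->].
  rewrite inE; apply/imsetP => -[j _ /first_axis_inj/natr_Zn_inj e].
  have /negP := disj _ (codom_f (fun i => (n - y i)%N) j).
  by apply; rewrite -e //; exact: (codom_f y).
rewrite !big_imset /=; first last.
- move=> i j _ _ /first_axis_inj/natr_Zn_inj e; apply: y_inj; exact: e.
- move=> i j _ _ /first_axis_inj/natr_Zn_inj e; apply: y_inj.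
  by have := e (ny_lt i) (ny_lt j); have := y_lt i; have := y_lt j; lia.
rewrite -big_split /=; apply: eq_big => // i _.
by rewrite !rV_char_first_axis !Zn_char_mul_nat.
Qed.

(** Orthogonality gives the sum over the whole group; the element [0], contributing [1], and the
    connection set are then removed. *)
Lemma compl_conn_set_char_sum (r : 'rV['Z_n]_h.+1) :
  \sum_(d in ~: (0 |: conn_set n h.+1 y)) rV_char R r d =
  (n ^ h.+1 * (r == 0))%:R - 1 - \sum_(d in conn_set n h.+1 y) rV_char R r d.
Proof.
have := rV_char_sum R n_gt1 r.
under eq_bigr do rewrite rV_charC.
rewrite (bigID (mem (0 |: conn_set n h.+1 y))) /= => e.
have -> : (n ^ h.+1)%N = #|'rV['Z_n]_h.+1|.
  by rewrite card_mx card_ord Zp_cast // mul1n.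
rewrite -e big_setU1 ?conn_set_neq0 //= rV_char0r.
under eq_bigl do rewrite finset.in_setC.
move: (\sum_(i | i \notin _) _) (\sum_(d in conn_set _ _ _) _) => x z; ring.
Qed.

End ConnSet.
End FirstAxis.

(** * Eigenvalues as values of integer polynomials *)

Section Eigenvalues.
Local Open Scope complex_scope.
Variables (R : realType) (n m : nat) (y : 'I_m -> nat).
Hypothesis n_gt1 : (1 < n)%N.

(** The variable is negated because the evaluation point is [zeta = - omega], whose order divides
    [p ^ s]; at [1] the signs then record parities of exponents. *)
Definition eig_poly (j : nat) : {poly int} :=
  \sum_i ((- 'X) ^+ (j * y i) + (- 'X) ^+ (j * (n - y i))).

Definition eig_val (j : nat) : R :=
  \sum_i 2 * cos (2 * pi * ((j * y i)%:R / n%:R)).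

Lemma turn_addN (x : R) : turn x + turn (- x) = (2 * cos (2 * pi * x))%:C.
Proof.
rewrite /turn mulrN /cis cosN sinN; apply/eqP.
by rewrite eq_complex /= subrr eqxx andbT [2 * cos _]mulr_natl mulr2n.
Qed.

Lemma eig_valE j : (forall i, (y i <= n)%N) ->
  (eig_val j)%:C = \sum_i (turn n%:R^-1 ^+ (j * y i) +
                           turn n%:R^-1 ^+ (j * (n - y i))).
Proof.
move=> yn; rewrite /eig_val rmorph_sum /=; apply: eq_bigr => i _.
rewrite -turn_addN -!turn_mulrn; congr (_ + _); first by rewrite mulr_natl.
(* The angles belonging to [n - y i] and [- y i] differ by [j] full turns. *)
rewrite -[_ *+ (j * (n - _))]mulr_natl; apply/esym/(@turnB_int _ _ _ j).
rewrite opprK mulnBr natrB ?leq_mul2l ?yn ?orbT //.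
rewrite !natrM -[j%:~R]/(j%:R); field.
by rewrite pnatr_eq0; lia.
Qed.

Lemma horner_eig_poly j (z : R[i]) : (map_poly intr (eig_poly j)).[z] =
  \sum_i ((- z) ^+ (j * y i) + (- z) ^+ (j * (n - y i))).
Proof.
rewrite rmorph_sum horner_sum; apply: eq_bigr => i _.
by rewrite rmorphD !rmorphXn rmorphN /= map_polyX !hornerE.
Qed.

Lemma eig_poly1_even j : ~~ odd j -> (eig_poly j).[1] = (2 * m)%:R.
Proof.
move=> je; rewrite horner_sum; transitivity (\sum_(i < m) 2 : int).
  apply: eq_bigr => i _; rewrite !hornerE -signr_odd -[X in _ + X]signr_odd.
  by rewrite !oddM (negPf je).
by rewrite sumr_const card_ord -mulrnA.
Qed.

(** As [n] is even, [n - y i] has the parity of [y i]: the index [i] contributes [-2] if [y i] is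
    odd and [2] otherwise. *)
Lemma eig_poly1_odd j l : odd j -> ~~ odd n -> (forall i, (y i <= n)%N) ->
  (l <= m)%N -> (forall i : 'I_m, (i < l)%N -> odd (y i)) ->
  (forall i : 'I_m, (l <= i)%N -> ~~ odd (y i)) ->
  (eig_poly j).[1] = (2 * m)%:R - (4 * l)%:R.
Proof.
move=> jo ne yn lm yo ye; rewrite horner_sum.
transitivity (\sum_(i < m) (2 - (if (i < l)%N then 4 else 0)) : int).
  apply: eq_bigr => i _; rewrite !hornerE -signr_odd -[X in _ + X]signr_odd.
  rewrite !oddM jo oddB ?yn // (negPf ne) /=.
  by have [/yo|/ye /negPf] := ltnP i l => ->.
rewrite sumrB sumr_const card_ord -big_mkcond /=.
rewrite -(big_ord_widen m (fun=> 4)) //.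
by rewrite sumr_const card_ord -!mulrnA.
Qed.

End Eigenvalues.

(** * Fractional revival in the complement *)

(** Parallelogram identity; it normalises the coefficients [alpha] and [beta]. *)
Lemma half_sum_diff_norm (C : numClosedFieldType) (u w : C) :
  `|u| = 1 -> `|w| = 1 -> `|(u + w) / 2| ^+ 2 + `|(u - w) / 2| ^+ 2 = 1.
Proof.
move=> u1 w1.
have uu : u * u^* = 1 by rewrite -normCK u1 expr1n.
have ww : w * w^* = 1 by rewrite -normCK w1 expr1n.
rewrite !normf_div !expr_div_n normr_nat !normCK rmorphD rmorphB /=.
rewrite -mulrDl -[RHS](_ : (2 * (u * u^*) + 2 * (w * w^*)) / 2 ^+ 2 = 1).
  by congr (_ / _); ring.
by rewrite uu ww; field.
Qed.

Theorem theorem5p1 (R : realType) (p s h m l : nat) (y : 'I_m -> nat)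
  (p_prime : prime p) (p_odd : odd p) (s_gt1 : (1 < s)%N) (h_gt1 : (1 < h)%N)
  (l_gt0 : (1 <= l)%N) (l_le_m : (l <= m)%N)
  (y_bound : forall i : 'I_m, (1 <= y i <= 2 * p ^ s - 1)%N)
  (y_odd : forall i : 'I_m, (i < l)%N -> odd (y i))
  (y_even : forall i : 'I_m, (l <= i)%N -> ~~ odd (y i))
  (p_l_coprime : coprime p l)
  (y_distinct : uniq ([seq y i | i : 'I_m] ++
                      [seq (2 * p ^ s - y i)%N | i : 'I_m]))
  (a b : 'rV['Z_(2 * p ^ s)]_h)
  (b_sub_a : b - a = first_axis h ((p ^ s)%N%:R : 'Z_(2 * p ^ s))) :
  PGFR R (gcompl (Cay (conn_set (2 * p ^ s) h y))) a b.
Proof.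
case: h h_gt1 a b b_sub_a => [//|h] _ a b b_sub_a.
set n := (2 * p ^ s)%N in y_bound y_distinct a b b_sub_a *.
have p_gt1 : (1 < p)%N by exact: prime_gt1.
have ps_gt0 : (0 < p ^ s)%N by rewrite expn_gt0 prime_gt0.
have n_gt1 : (1 < n)%N by rewrite /n; lia.
have p_dvd_n : (p %| n)%N by rewrite dvdn_mull // dvdn_exp // ltnW.
have n_even : ~~ odd n by rewrite /n oddM.
have yn i : (y i <= n)%N by have := y_bound i; lia.
have p0 : p%:R != 0 :> R by rewrite pnatr_eq0 -lt0n prime_gt0.
have n0 : n%:R != 0 :> R by rewrite pnatr_eq0; lia.
pose omega : R[i] := turn n%:R^-1.
have omega_ps : omega ^+ (p ^ s) = -1.
  rewrite -turn_mulrn -turn_half; congr turn.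
  by rewrite -mulr_natl /n natrM; field; rewrite pnatr_eq0 -lt0n ps_gt0.
have zeta_ps : (- omega) ^+ (p ^ s) = 1.
  by rewrite exprNn omega_ps -signr_odd oddX p_odd orbT expr1 mulrNN mulr1.
pose lam (j : 'Z_n) : R := eig_val R n y j.
have lamE (j : 'Z_n) :
    (map_poly intr (eig_poly n y j)).[- omega] = (lam j)%:C%C.
  by rewrite horner_eig_poly opprK /lam eig_valE.
have approx k : exists q : nat, forall j : 'Z_n,
    `|turn ((q%:R + p%:R^-1) * lam j) - turn ((eig_poly n y j).[1]%:~R / p%:R)|
    < k.+1%:R^-1 :> R[i].
  by apply: (turn_approx p_prime zeta_ps lamE); rewrite invr_gt0 ltr0n.
have {approx} [q hq] := choice approx.
pose tau k : R := (q k)%:R + p%:R^-1.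
pose theta (r : 'rV['Z_n]_h.+1) : R :=
  (n ^ h.+1 * (r == 0))%:R - 1 - lam (r 0 ord0).
(* [u] and [w] are the limits on characters with even and odd first coordinate; the summand [1]
   comes from the [- 1] in [theta]. *)
pose u : R[i] := turn ((1 + (2 * m)%:R) / p%:R).
pose w : R[i] := turn ((1 + (2 * m)%:R - (4 * l)%:R) / p%:R).
(* Equality would force [p] to divide [4 l], impossible for [p] odd and coprime to [l]. *)
have uw : u != w.
  apply/eqP => /turn_inj_mod1[c hc].
  have : (4 * l)%:R = (c * p%:Z)%:~R :> R.
    by rewrite intrM -hc; field.
  rewrite -[(4 * l)%:R]/((4 * l)%N%:~R) => /intr_inj e.
  have : (p %| 4 * l)%N.
    have : (p%:Z %| (4 * l)%N%:Z)%Z by rewrite e dvdz_mull.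
    by [].
  rewrite Gauss_dvdl // -[4%N]/(2 ^ 2)%N Euclid_dvdX // andbT dvdn_prime2 //.
  by move=> /eqP p2; move: p_odd; rewrite p2.
have char_ab (r : 'rV['Z_n]_h.+1) :
    rV_char R r (a - b) = (-1) ^+ (r 0 ord0 : nat).
  have e : rV_char R r (a - b) * rV_char R r (b - a) = 1.
    by rewrite -rV_charDr // addrA subrK subrr rV_char0r.
  have e' : rV_char R r (b - a) = (-1) ^+ (r 0 ord0 : nat).
    rewrite b_sub_a rV_char_first_axis Zn_char_mul_nat //.
    by rewrite mulnC exprM omega_ps.
  move: e; rewrite e' => /(congr1 ( *%R^~ ((-1) ^+ (r 0 ord0 : nat)))).
  by rewrite mul1r -mulrA -expr2 sqrr_sign mulr1.
have -> : gcompl (Cay (conn_set n h.+1 y)) = Cay (~: (0 |: conn_set n h.+1 y)).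
  by apply/funext => v; apply/funext => v'; exact: gcompl_Cay.
(* The half-sum and half-difference solve [alpha + beta = u] and [alpha - beta = w]. *)
apply: (@PGFR_Cay R _ _ (@rV_char R n h.+1) _ _ _ theta
  (fun k => 2 * pi * tau k) a b ((u + w) / 2) ((u - w) / 2)).
- by move=> r v v'; exact: rV_charDr.
- exact: rV_char_sum.
- by rewrite !inE eqxx.
- move=> r; rewrite compl_conn_set_char_sum // conn_set_char_sum //.
  by rewrite -eig_valE // !rmorphB /= rmorph_nat rmorph1.
- apply/eqP => ab; move: b_sub_a; rewrite ab subrr -(first_axis0 n h).
  move=> /first_axis_inj; rewrite -[0]/(0%:R) => /natr_Zn_inj; rewrite /n; lia.
- by rewrite mulf_neq0 ?invr_eq0 ?pnatr_eq0 // subr_eq0.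
- exact: half_sum_diff_norm (norm_turn _) (norm_turn _).
move=> r.
set j := r 0 ord0.
have -> : (u + w) / 2 + (u - w) / 2 * rV_char R r (a - b) =
    turn (p%:R^-1) * turn ((eig_poly n y j).[1]%:~R / p%:R).
  transitivity (if odd j then w else u).
    rewrite char_ab -/j -signr_odd; move: (u) (w) => u' w'.
    by case: (odd j); rewrite ?expr0 ?expr1; field.
  rewrite -turnD; case: ifPn => jo; congr turn.
    by rewrite (eig_poly1_odd jo n_even yn l_le_m y_odd y_even) rmorphB /=
      !rmorph_nat; field.
  by rewrite (eig_poly1_even n y jo) !rmorph_nat; field.
have turnE k : cis (- (2 * pi * tau k * theta r)) =
    turn (p%:R^-1) * turn (tau k * lam j).
  rewrite -mulrA -mulrN -[LHS]/(turn _) -turnD.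
  (* As [p] divides [n], the summand [n ^ h.+1] present at [r = 0] only adds [N' p (q k + 1/p)], a
     whole number of turns. *)
  have [N' hN] : exists N' : nat, (n ^ h.+1 * (r == 0%R) = N' * p)%N.
    by apply/dvdnP; rewrite dvdn_mulr // dvdn_exp.
  have tauE : - (tau k * theta r) - (p%:R^-1 + tau k * lam j) =
      ((q k)%:Z - (q k * N' * p + N')%N%:Z)%:~R.
    rewrite /theta hN -/j /tau rmorphB /= -!pmulrn natrD !natrM; field.
    exact: p0.
  exact: turnB_int tauE.
move=> e e0.
have [N hN] := complex_archimedean e^-1.
exists N => k Nk; rewrite turnE -mulrBr normrM norm_turn mul1r distrC.
apply: lt_trans (hq k j) _; move: hN; rewrite gtr0_norm ?invr_gt0 // => hN.
rewrite -[ltRHS]invrK ltf_pV2 ?posrE ?invr_gt0 ?ltr0n //.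
by apply: lt_le_trans hN _; rewrite ler_nat ltnW.
Qed.
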